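(* Let $F$ be a Ferrers board whose longest row and longest column have the same length, and let $S$ be an $F$-sequence. Then: (a) there exists $P \in S_F(231)$ such that $S(P,F) = S$ if and only if $(F,S)$ satisfies the 231-conditions; (b) there exists $P \in S_F(312)$ such that $S(P,F) = S$ if and only if $(F,S)$ satisfies the 312-conditions.
   Context: Let $\mathcal{A}$ be an $m\times m$ array of unit squares in the $xy$-plane with its bottom left corner at the origin. The corners of squares are called vertices. For a vertex $V=(a,b)$, $R(V)$ denotes the rectangular array of squares bounded by the lines $x=0$, $x=a$, $y=0$, $y=b$ (empty if $a=0$ or $b=0$). A Ferrers board is a subset $F$ of $\mathcal{A}$ (for some $m$) such that $R(V)\subseteq F$ for each vertex $V$ of $F$ (a vertex of $F$ is a corner of a square of $F$). So $F$ is left- and bottom-justified. The right/up border of $F$ is the border of $F$ excluding the vertical left-hand side and the horizontal bottom side: it is the lattice path of unit rightward and downward steps along the boundary of $F$ from the top left corner $(0,h)$ of $F$ to the bottom right corner $(w,0)$, where $h$ is the length of the longest column and $w$ that of the longest row; both endpoints are vertices of the right/up border. A rook placement on $F$ is a subset of the squares of $F$ (the squares containing ''markers'') with at most one square in each row and at most one in each column of $F$; a full rook placement has exactly one marker in each row and each column of $F$. A rook placement $P$ on $F$ avoids a pattern $\tau$ if for every vertex $V$ on the right/up border of $F$ the permutation order-isomorphic to the restriction of $P$ to $R(V)$ (markers read left to right, by height) avoids $\tau$ in the usual sense (has no subsequence order-isomorphic to $\tau$). $S_F(\tau)$ is the set of all full rook placements on $F$ that avoid $\tau$. For a rook placement $P$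 on $F$ and a vertex $V$ of $F$, $S(P,V)$ is the maximal length of an increasing sequence of markers of $P$ in $R(V)$ (each successive marker strictly to the right of and strictly above the previous one); it is $0$ if $R(V)$ contains no marker. For a full rook placement $P$, $S(P,F)$ denotes the sequence of values $S(P,V)$ for all vertices $V$ on the right/up border of $F$, in order, starting with the top left corner of $F$. An $F$-sequence $S$ is a sequence of nonnegative integers $S(V)$ assigned to the vertices $V$ on the right/up border of $F$, in order, starting with the vertex at the top left corner. ''Directly to the left of'' and ''directly below'' mean at distance one unit to the left, respectively below. The 231-conditions for $(F,S)$ are: (i) (monotonicity conditions) if $V_1, V_2$ are vertices on the right/up border and $V_1$ is either directly to the left of $V_2$ or directly below $V_2$, then $S(V_1)\le S(V_2)\le S(V_1)+1$; (ii) (0-conditions) the first and last values of $S$ are $0$, and there do not exist consecutive vertices $V_1,V_2$ on the right/up border with $S(V_1)=0=S(V_2)$; (iii) (diagonal condition) if $V_1$ and $V_2$ are vertices on the right/up border that are at the left and right ends, respectively, of a diagonal (line segment) of slope $-1$ lying entirely within $F$, then $S(V_1)\le S(V_2)$. The 312-conditions for $(F,S)$ are the same as the 231-conditions, except that the inequality in (iii) is reversed: $S(V_1)\ge S(V_2)$. *)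

(* Defs.v *)
From mathcomp Require Import all_boot.

Set Implicit Arguments.
Unset Strict Implicit.
Unset Printing Implicit Defensive.

(* The pair (i, j) is the unit square [i, i+1] x [j, j+1]: the first component
   is the column, the second the row, both numbered from 0. *)
Notation square m := ('I_m * 'I_m)%type.

Definition vertex : Type := (nat * nat)%type.

Section Boards.
Variable m : nat.
Implicit Types (F P Q : {set square m}) (V : vertex) (S : seq nat).

Definition has_square F (i j : nat) : bool :=
  [exists x : square m in F, (x.1 == i :> nat) && (x.2 == j :> nat)].

Definition is_vertex F V : bool :=
  [exists x : square m in F, ((V.1 == x.1) || (V.1 == x.1.+1))
               && ((V.2 == x.2) || (V.2 == x.2.+1))].

Definition rect V : {set square m} := [set x : square m | (x.1 < V.1) && (x.2 < V.2)].

Definition ferrers F : Prop := forall V, is_vertex F V -> rect V \subset F.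

Definition row F (j : 'I_m) : {set square m} := [set x : square m in F | x.2 == j].
Definition column F (i : 'I_m) : {set square m} := [set x : square m in F | x.1 == i].

Definition longest_row F : nat := \max_(j < m) #|row F j|.
Definition longest_column F : nat := \max_(i < m) #|column F i|.

(* The right/up border is walked from (0, longest_column F): go right when the
   edge to the right is the top side of a square of F, otherwise go down; after
   longest_row F + longest_column F steps the walk is at (longest_row F, 0).
   The border of the empty board is the single vertex (0, 0). *)
Definition border_step F V : vertex :=
  if (0 < V.2) && has_square F V.1 V.2.-1 then (V.1.+1, V.2) else (V.1, V.2.-1).

Definition border F : seq vertex :=
  traject (border_step F) (0, longest_column F)
          (longest_row F + longest_column F).+1.

Definition rook_placement F P : Prop :=
  [/\ P \subset F,
      forall i : 'I_m, #|column P i| <= 1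
    & forall j : 'I_m, #|row P j| <= 1].

(* The array may be larger than F: only the nonempty rows and columns count. *)
Definition full_rook_placement F P : Prop :=
  [/\ rook_placement F P,
      forall i : 'I_m, column F i != set0 -> #|column P i| = 1
    & forall j : 'I_m, row F j != set0 -> #|row P j| = 1].

Definition heights Q : seq nat :=
  [seq val j | i <- enum 'I_m, j <- [seq j <- enum 'I_m | (i, j) \in Q]].

End Boards.

(* One-line notation, with values 1, ..., size s, of the permutation that is
   order-isomorphic to a sequence s of distinct numbers. *)
Definition standardize (s : seq nat) : seq nat :=
  [seq count (fun y => y <= x) s | x <- s].

Definition order_isomorphic (s t : seq nat) : Prop :=
  size s = size t /\
  forall i j, i < size s -> j < size s ->
    (nth 0 s i < nth 0 s j) = (nth 0 t i < nth 0 t j).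

Definition avoids (tau s : seq nat) : Prop :=
  ~ exists2 t, subseq t s & order_isomorphic t tau.

Section Statistics.
Variable m : nat.
Implicit Types (F P : {set square m}) (V : vertex) (S : seq nat).

Definition perm_of_rect P V : seq nat := standardize (heights (P :&: rect m V)).

Definition placement_avoids F (tau : seq nat) P : Prop :=
  forall V, V \in border F -> avoids tau (perm_of_rect P V).

Definition full_avoiding F (tau : seq nat) P : Prop :=
  full_rook_placement F P /\ placement_avoids F tau P.

Definition right_above : rel (square m) :=
  fun x y => (x.1 < y.1) && (x.2 < y.2).

(* The columns of an increasing sequence are distinct, so no length exceeds m. *)
Definition max_increasing P V : nat :=
  \max_(n < m.+1 | [exists t : n.-tuple (square m),
                      all (mem (P :&: rect m V)) t && sorted right_above t]) n.

Definition border_statistic F P : seq nat :=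
  [seq max_increasing P V | V <- border F].

(* The k-th entry of S is the value assigned to the k-th border vertex. *)
Definition is_Fsequence F S : Prop := size S = size (border F).

Definition value_at F S V : nat := nth 0 S (index V (border F)).

Definition directly_left V1 V2 : Prop := V2 = (V1.1.+1, V1.2).
Definition directly_below V1 V2 : Prop := V2 = (V1.1, V1.2.+1).

Definition monotonicity_conditions F S : Prop :=
  forall V1 V2, V1 \in border F -> V2 \in border F ->
    directly_left V1 V2 \/ directly_below V1 V2 ->
    value_at F S V1 <= value_at F S V2 <= (value_at F S V1).+1.

Definition zero_conditions S : Prop :=
  [/\ head 0 S = 0, last 0 S = 0
    & forall k, k.+1 < size S -> ~ (nth 0 S k = 0 /\ nth 0 S k.+1 = 0)].

(* V1 and V2 are the left and right ends of a segment of slope -1 within F.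
   Such a segment is a union of diagonals of unit squares, and the interior of
   each diagonal lies in no other square. *)
Definition diagonal_in F V1 V2 : Prop :=
  exists2 k, 0 < k /\ (V2.1 = V1.1 + k /\ V1.2 = V2.2 + k)
    & forall i, i < k -> has_square F (V1.1 + i) (V1.2 - i.+1).

Definition conditions231 F S : Prop :=
  [/\ monotonicity_conditions F S, zero_conditions S
    & forall V1 V2, V1 \in border F -> V2 \in border F ->
        diagonal_in F V1 V2 -> value_at F S V1 <= value_at F S V2].

Definition conditions312 F S : Prop :=
  [/\ monotonicity_conditions F S, zero_conditions S
    & forall V1 V2, V1 \in border F -> V2 \in border F ->
        diagonal_in F V1 V2 -> value_at F S V1 >= value_at F S V2].

End Statistics.

(* Main.v *)
Require Import Defs.
From mathcomp Require Import all_boot zify.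

Set Implicit Arguments.
Unset Strict Implicit.
Unset Printing Implicit Defensive.

(** Write n for the common length of the longest row and column, h i for the
    height of column i, and let r be the row of the marker in the last column
    of a 231-avoiding full placement P. Below height h (n - 1) the markers above
    row r must decrease, so on the last vertical line S(P, _) jumps for the last
    time right above row r; hence r is read off S(P, F). Deleting the last
    column and row r gives a 231-avoiding placement P' on the board with heights
    h i - 1, and S(P', _) is again determined by S(P, _): it agrees with it away
    from the new last vertical line, agrees with it there up to height r, and is
    constant between r and h (n - 1) - 1. Both directions are proved by
    induction along this reduction. In the sufficiency direction the diagonal
    condition is what makes the reduced sequence satisfy the 0-conditions and
    the reinserted marker create no 231. Transposing F exchanges 231 with 312
    and the two diagonal conditions. *)

(** * Increasing sequences *)

(* Column [i] has its marker in row [p i]; a longest increasing sequence in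
   columns [< a] and rows [< b] either avoids the last column or ends in it. *)
Fixpoint lis (p : nat -> nat) (a b : nat) : nat :=
  if a is i.+1 then
    if p i < b then maxn (lis p i b) (lis p i (p i)).+1 else lis p i b
  else 0.

Lemma inj_prefix (p : nat -> nat) a b : a <= b ->
  {in gtn b &, injective p} -> {in gtn a &, injective p}.
Proof. by move=> ab; apply: sub_in2 => i /leq_trans; apply. Qed.

Section Lis.
Variable p : nat -> nat.

Lemma eq_lis_rows a b c :
  (forall i, i < a -> (p i < b) = (p i < c)) -> lis p a b = lis p a c.
Proof.
elim: a => //= a IH E; rewrite E // IH // => i ia; apply: E; lia.
Qed.

Lemma lis_homo a b c : b <= c -> lis p a b <= lis p a c.
Proof.
move=> bc; elim: a => //= a IH; case: ifP => pb; last by case: ifP; lia.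
by rewrite (leq_trans pb bc); lia.
Qed.

Lemma lis_homo_columns a a' b : a <= a' -> lis p a b <= lis p a' b.
Proof.
move=> le; rewrite -(subnK le); elim: (a' - a) => // k IH; rewrite addSn /=; case: ifP; lia.
Qed.

Lemma lis_columnS a b : lis p a.+1 b <= (lis p a b).+1.
Proof. by rewrite /=; case: ifP => // pb; have := @lis_homo a _ _ (ltnW pb); lia. Qed.

Lemma lis_lt i a b : i < a -> p i < b -> lis p i (p i) < lis p a b.
Proof. by move=> /(@lis_homo_columns _ _ b) + pb; rewrite /= pb; lia. Qed.

(** Row [b] holds at most one marker in these columns, and a chain below height [b.+1] can use it
    only as its top. *)
Lemma lis_rowS a b : {in gtn a &, injective p} -> lis p a b.+1 <= (lis p a b).+1.
Proof.
elim: a => //= a IH inj.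
have {}IH : lis p a b.+1 <= (lis p a b).+1.
  exact: IH (inj_prefix (leqnSn a) inj).
case: ifP => pb; last by case: ifP; lia.
case: ifP => pb'; first lia.
have -> : p a = b by lia.
rewrite (@eq_lis_rows a b.+1 b) ?maxnn => [|i ia]; last first.
  have : p i != p a by apply/eqP => /inj; rewrite !inE => E; lia.
  lia.
lia.
Qed.

Lemma lis_row0 a : lis p a 0 = 0.
Proof. by elim: a. Qed.

Lemma leq_lis a b : lis p a b <= a.
Proof. by elim: a => //= a IH; have := lis_columnS a b; rewrite /=; lia. Qed.

(** If opening row [b] lengthens the longest chain, the new chain must end in the marker of that
    row; without its top it is a chain to the left of and below that marker. *)
Lemma lis_row_attained a b : {in gtn a &, injective p} ->
  lis p a b < lis p a b.+1 ->
  exists2 u, u < a /\ p u = b & lis p a b <= lis p u b.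
Proof.
elim: a => //= a IH inj.
have {}IH : lis p a b < lis p a b.+1 ->
  exists2 u, u < a /\ p u = b & lis p a b <= lis p u b.
  exact: IH (inj_prefix (leqnSn a) inj).
case: (ltngtP (p a) b) => pb.
- rewrite (ltnW pb : p a < b.+1) => lt.
  have lt' : lis p a b < lis p a b.+1 by lia.
  have := @lis_rowS a b (inj_prefix (leqnSn a) inj).
  by have [u [ua pu] le] := IH lt'; exists u; lia.
- by case: ifP => [|_ /IH[u [ua pu] le]]; [lia | exists u => //; lia].
by move=> _; exists a => //; lia.
Qed.

Lemma eq_lis_columns a a' b : a <= a' ->
  (forall k, a <= k < a' -> b <= p k) -> lis p a' b = lis p a b.
Proof.
move=> /subnK <-; elim: (a' - a) => // d IH above; rewrite addSn /= ltnNge.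
by rewrite above /= ?IH // => [k kd|]; [apply: above|]; lia.
Qed.

(* Above row [r] the markers decrease, so a chain leaves the rows below [r] at
   most once. *)
Lemma lis_above_decreasing a r c :
    {in gtn a, forall i, p i != r} ->
    (forall i j, i < j < a -> r < p i -> p i < p j -> p j < c -> False) ->
  lis p a c <= (lis p a r).+1.
Proof.
elim: a => //= a IH nr dec.
have {}IH : lis p a c <= (lis p a r).+1.
  apply: IH => [i ia|i j ij]; first by apply: nr; rewrite inE ltnW.
  by apply: dec; lia.
case: ifP => pc; last by case: ifP; lia.
case: ifP => pr; first by lia.
have : p a != r by apply: nr; rewrite inE.
move=> ne; rewrite (@eq_lis_rows a (p a) r); first by lia.
move=> i ia; have : p i != r by apply: nr; rewrite inE; lia.
case: (ltnP r (p i)) => // ri; last by lia.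
case: (ltnP (p i) (p a)) => lt; last by lia.
by case: (dec i a); lia.
Qed.

End Lis.

(** [bump r] is the increasing relabelling of rows that skips [r], so it undoes the deletion of row
    [r]. *)
Lemma lis_bump p p' r a b : (forall i, i < a -> p i = bump r (p' i)) ->
  lis p' a b = lis p a (bump r b).
Proof.
elim: a b => //= a IH b E; rewrite E //.
have ltb x y : (bump r x < bump r y) = (x < y) by rewrite /bump; lia.
by rewrite ltb !IH // => i ia; apply: E; lia.
Qed.

(** * The induction along the last column *)

(** [board0] fixes the longest column, [board_eq0] the longest row: exactly the first [n] columns
    are nonempty. *)
Record board (n : nat) (h : nat -> nat) : Prop := Board {
  board0 : h 0 = n;
  board_homo : forall i j, i <= j -> h j <= h i;
  board_eq0 : forall i, (h i == 0) = (n <= i)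
}.

Record placement (n : nat) (h p : nat -> nat) : Prop := Placement {
  placement_lt : forall i, i < n -> p i < h i;
  placement_inj : {in gtn n &, injective p}
}.

(** The smallest rectangle containing the three markers has its upper right square in column [k] and
    row [p j]; [p j < h k] says that this square is on the board. *)
Definition avoids231 n (h p : nat -> nat) : Prop :=
  forall i j k, i < j < k -> k < n -> p k < p i < p j -> p j < h k -> False.

(* A border vertex [(a, b)] with [a < n] starts a horizontal border edge exactly
   when [b = h a]. The 0-conditions are merged with monotonicity: two consecutive
   zeros mean that the larger of two adjacent values is [0]. *)
Record board_conditions (n : nat) (h : nat -> nat) (s : nat -> nat -> nat) : Prop :=
  BoardConditions {
  right_step : forall a, a < n ->
    s a (h a) <= s a.+1 (h a) <= (s a (h a)).+1 /\ 0 < s a.+1 (h a);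
  up_step : forall a b, a <= n -> h a <= b < h a.-1 ->
    s a b <= s a b.+1 <= (s a b).+1 /\ 0 < s a b.+1;
  start0 : s 0 n = 0;
  end0 : s n 0 = 0;
  diagonal : forall a a' b', a < a' <= n -> h a' <= b' <= h a'.-1 ->
    a + h a = a' + b' -> (forall i, a <= i < a' -> a + h a <= i + h i) ->
    s a (h a) <= s a' b'
}.

(** As the longest row and column have equal length, injectivity suffices for fullness: [n] columns
    use [n] distinct rows out of [n]. *)
Lemma placement_onto n h p : board n h -> placement n h p ->
  forall b, b < n -> exists2 i, i < n & p i = b.
Proof.
move=> [h0 hh _] [lt inj] b bn.
have pn (i : 'I_n) : p i < n.
  by rewrite -{2}h0 (leq_trans (lt i _)) ?hh.
have fI : injective (fun i => Ordinal (pn i)).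
  by move=> i j [] /inj E; apply/val_inj/E; rewrite inE /=.
have /codomP[i /(congr1 val)/= Ei] : Ordinal bn \in codom (fun i => Ordinal (pn i)).
  by rewrite injF_onto.
by exists i.
Qed.

(** The deleted row lies below the height of the last column, hence meets every remaining column and
    lowers each height by one. *)
Definition remove_last n (h : nat -> nat) i := if i < n then (h i).-1 else 0.

Lemma board_remove n h : board n.+1 h -> (0 < n -> 1 < h n.-1) ->
  board n (remove_last n h).
Proof.
move=> [h0 hh hz] h1; split; rewrite /remove_last.
- by case: n h0 {h1 hz} => //= n ->.
- by move=> i j /[dup] ij /hh; do 2!case: ifP; lia.
move=> i; case: ifP => [lt|]; last by lia.
have : h n.-1 <= h i by apply: hh; lia.
lia.
Qed.

Lemma necessity n h p : board n h -> placement n h p -> avoids231 n h p ->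
  board_conditions n h (lis p).
Proof.
elim: n h p => [|n IH] h p bd pl av.
  have hz i : h i = 0 by apply/eqP; rewrite (board_eq0 bd).
  by split=> // [a b|a a' b']; rewrite ?hz; lia.
have [h0 hh hz] := bd; have [lt inj] := pl.
split.
- move=> a an; split; last first.
    by apply: leq_ltn_trans (lis_lt (ltnSn a) (lt a an)).
  by rewrite lis_columnS lis_homo_columns.
- move=> a b an /andP[hb bh]; split; last first.
    (* Since [h a <= b], the marker of row [b] lies in a column before [a], which makes the upper
       value positive. *)
    have [|i ni pi] := @placement_onto _ _ _ bd pl b.
      by rewrite -h0; apply: leq_trans bh (hh _ _ _).
    apply: leq_ltn_trans (lis_lt (i := i) _ _); rewrite ?pi //.
    rewrite ltnNge; apply/negP => /hh; have := lt i ni; lia.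
  by rewrite lis_rowS ?lis_homo //; apply: inj_prefix inj.
- by [].
- by rewrite lis_row0.
(* Only the diagonal condition remains. It is pulled back from the placement [q] left after deleting
   the last column and row [r]. *)
set r := p n; set c := h n; have rc : r < c by apply: lt.
have ch i : i <= n -> c <= h i by apply: hh.
have pr i : i < n -> p i != r.
  by move=> ?; apply/eqP => /inj; rewrite !inE; lia.
pose q i := unbump r (p i); pose k := remove_last n h.
have kE i : i < n -> k i = (h i).-1 by rewrite /k /remove_last => ->.
have pq i : i < n -> p i = bump r (q i).
  by move=> /pr pi; rewrite unbumpK.
have bd' : board n k.
  apply: board_remove => // n0.
  have := lt n.-1; have : p n.-1 != r by apply: pr; lia.
  have := ch n.-1; lia.
have pl' : placement n k q.
  split=> [i ni|i j]; last first.
    rewrite !inE => ni nj E; apply: inj; rewrite ?inE; try lia.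
    by rewrite !pq // E.
  rewrite kE //; have := lt i; have := ch i; have := pq i ni; rewrite /bump; lia.
have av' : avoids231 n k q.
  move=> i j l ijl ln qij; rewrite kE // => qj.
  have [pi pj pl''] : [/\ p i = bump r (q i), p j = bump r (q j) & p l = bump r (q l)].
    by split; apply: pq; lia.
  by apply: (av i j l); rewrite ?pi ?pj ?pl'' // /bump; lia.
have [_ _ _ _ dg] := IH k q bd' pl' av'.
have lisq a b : a <= n -> lis q a b = lis p a (bump r b).
  by move=> an; apply: lis_bump => i ia; apply: pq; lia.
have lisq1 a b : a <= n -> c <= b -> lis p a b = lis q a b.-1.
  by move=> an cb; rewrite lisq // /bump; congr lis; lia.
have last b : b < c -> lis q n b <= lis p n.+1 b.
  move=> bc; rewrite lisq //; case: (leqP b r) => br.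
    rewrite (@eq_lis_rows p n _ b) ?lis_homo_columns // => i /pr.
    rewrite /bump; lia.
  have -> : bump r b = b.+1 by rewrite /bump; lia.
  (* Two markers rising between row [r] and height [c] would form a 231 with the last marker. So
     cutting the chains at [r] costs at most one, and the last marker makes up for it. *)
  rewrite (leq_trans (@lis_above_decreasing p n r b.+1 _ _)) //.
  - by move=> i j ij ri rij jb; apply: (av i j n); rewrite -?/r -?/c; lia.
  by apply: lis_lt.
move=> a a' b' /andP[aa an] hb' sum above.
have ca : c <= h a by apply: ch; lia.
(* For [a' <= n] both ends of the diagonal move down by one. For [a' = n.+1] the left end moves down
   and the right end moves left to [(n, b')]; when moreover [a = n], the two ends then coincide. *)
case: (ltnP n a') => [na|a'n]; last first.
  have ca' : c <= h a' by apply: ch.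
  rewrite !lisq1; try lia.
  have an' : a < n by lia.
  rewrite -kE //.
  have ha'1 : k a'.-1 = (h a'.-1).-1 by apply: kE; lia.
  have ka' : k a' <= (h a').-1 by rewrite /k /remove_last; case: ifP.
  apply: dg; rewrite ?(kE a an'); try lia.
  by move=> i ia; rewrite kE; have := above i ia; have := ch i; lia.
have {na an}Ea' : a' = n.+1 by lia.
subst a'; rewrite /= in hb'.
have bc : b' < c by have := above n; lia.
rewrite lisq1; try lia.
apply: leq_trans (last b' bc).
case: (ltngtP a n) => an; [|lia|]; last first.
  by subst a; have -> : (h n).-1 = b' by lia.
have hn1 := above n.-1; rewrite -kE //.
have kn1 : k n.-1 = (h n.-1).-1 by apply: kE; lia.
have kn : k n = 0 by rewrite /k /remove_last ltnn.
apply: dg; rewrite ?(kE a an); try lia.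
by move=> i ia; rewrite kE; have := above i; have := ch i; lia.
Qed.

(* Only a vertex entered by a downward step is in question. The border last crossed
   its antidiagonal before by a rightward step: the value there is positive, and
   the diagonal condition carries it to [(a, b)]. *)
Lemma board_conditions_gt0 n h s a b : board n h -> board_conditions n h s ->
  a <= n -> h a <= b <= h a.-1 -> n < a + b -> 0 < s a b.
Proof.
move=> [h0 hh hz] [rs us _ _ dg] an /andP[ab ba] nab.
case: (ltnP (h a) b) => [lt|ge].
  have [_] := us a b.-1 an ltac:(lia).
  by rewrite prednK //; lia.
have a0 : 0 < a by case: a ba nab {an ab ge} => //=; lia.
have {ab ge} Eb : b = h a by lia.
case: (ltngtP b (h a.-1)) => bh; [|lia|]; last first.
  have [_] := rs a.-1 ltac:(lia).
  by rewrite prednK // bh.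
(* Moving left from column [a.-1], [climb] looks for the last column whose top left corner lies
   below the antidiagonal of [(a, b)]; column 0 is one, because [n < a + b]. *)
suff climb j : j < a -> (forall i, j <= i < a -> a + b <= i + h i) -> 0 < s a b.
  apply: (climb a.-1); first lia.
  by move=> i ia; have -> : i = a.-1; lia.
elim: j => [|j IH] ja above; first by have := above 0; lia.
case: (leqP (a + b) (j + h j)) => hj.
  apply: IH => [|i ij]; first lia.
  by have [->|] := eqVneq i j => // ne; apply: above; lia.
have aj := above j.+1 ltac:(lia).
have Ej : h j.+1 = h j by have := hh j j.+1; lia.
have [_] := rs j ltac:(lia).
rewrite -Ej => /leq_trans; apply; rewrite Eb.
by apply: dg => [|||i ij]; try (have := above i); lia.
Qed.

(** The diagonal condition still holds when the right end lies above the antidiagonal of the left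
    end. If that antidiagonal meets another corner [(i, h i)] on the way, one passes to that corner;
    otherwise a rightward step leads to the next antidiagonal, below which no later corner falls. *)
Lemma board_conditions_above n h s : board n h -> board_conditions n h s ->
  forall a a' b', a < a' <= n -> h a' <= b' <= h a'.-1 ->
    a + h a <= a' + b' -> (forall i, a <= i < a' -> a + h a <= i + h i) ->
  s a (h a) <= s a' b'.
Proof.
move=> [h0 hh hz] [rs us _ _ dg] a a'.
have [d] := ubnP (a' - a); elim: d a => // d IH a da b' aa' hb' le above.
have [E|ne] := eqVneq (a + h a) (a' + b'); first exact: dg.
have [/existsP[[i ia'] /=/andP[ai /eqP Ei]]|nex] :=
  boolP [exists i : 'I_a', (a < i) && (i + h i == a + h a)].
  apply: (@leq_trans (s i (h i))).
    apply: dg => [|||j ij]; try lia.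
      by have := hh i.-1 i; lia.
    by apply: above; lia.
  apply: IH => [||||j ij]; try lia.
  by rewrite Ei; apply: above; lia.
have above1 i : a < i < a' -> a.+1 + h a <= i + h i.
  move=> ia; have := above i; suff : i + h i != a + h a by lia.
  apply: contraNneq nex => E; have ia' : i < a' by lia.
  by apply/existsP; exists (Ordinal ia'); rewrite /= E eqxx; lia.
have [/andP[le1 _] _] := rs a ltac:(lia).
apply: leq_trans le1 _.
have [Ea|nea] := eqVneq a.+1 a'.
  by move: hb' le ne; rewrite -Ea /= => hb' le ne; have -> : h a = b'; lia.
have Eh : h a.+1 = h a by have := hh a a.+1; have := above1 a.+1; lia.
by rewrite -Eh; apply: IH => [||||j ij]; rewrite ?Eh; try (apply: above1); lia.
Qed.

(** * The reduced sequence *)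

Section Step.
Variables (n : nat) (h : nat -> nat) (s : nat -> nat -> nat).
Hypotheses (bd : board n.+1 h) (cs : board_conditions n.+1 h s).

Let c := h n.
Let h' := remove_last n h.

(* If the last two columns had height [1], the diagonal condition would force two
   consecutive zeros. *)
Lemma removable : 0 < n -> 1 < h n.-1.
Proof.
have [h0 hh hz] := bd; have [rs us _ e0 dg] := cs.
move=> n0; have hn := hz n; rewrite ltnn in hn; have hn1 := hh n.-1 n (leq_pred n).
case: (ltngtP (h n.-1) 1) => // E; first lia.
have {}hn1 : h n = 1 by lia.
have hn2 : h n.+1 = 0 by apply/eqP; rewrite hz.
have [_] := rs n.-1 ltac:(lia).
rewrite prednK // E.
suff : s n 1 <= s n.+1 0 by rewrite e0; lia.
rewrite -{1}hn1; apply: dg; rewrite /= ?hn1 ?hn2; try lia.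
by move=> i ia; have -> : i = n; rewrite /c; lia.
Qed.

(** This recovers the row of the last marker from the values on the last vertical line. *)
Lemma last_rise : exists2 r, r < c &
  forall b, r < b <= c -> s n.+1 b = (s n.+1 r).+1.
Proof.
have [h0 hh hz] := bd; have [rs us _ e0 dg] := cs.
have c0 : 0 < c by rewrite lt0n hz -ltnNge.
have hn2 : h n.+1 = 0 by apply/eqP; rewrite hz.
have up b : b < c -> s n.+1 b <= s n.+1 b.+1 <= (s n.+1 b).+1 /\ 0 < s n.+1 b.+1.
  by move=> bc; apply: us; rewrite // hn2.
have mono d b : b <= d <= c -> s n.+1 b <= s n.+1 d.
  elim: d => [|d IH] bdc; first by have -> : b = 0 by lia.
  have [->//|ne] := eqVneq b d.+1; have [/andP[+ _] _] := up d ltac:(lia).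
  by apply: leq_trans; apply: IH; lia.
(* The least height that carries the top value is not 0, since the value at the bottom is 0 and the
   top one is positive; [r] is one less. *)
have ex : exists b, s n.+1 b == s n.+1 c by exists c.
case: (ex_minnP ex) => b /eqP Eb minb.
have b0 : 0 < b.
  case: b Eb {minb} => //; rewrite e0 => E.
  by have [_] := up c.-1 ltac:(lia); rewrite prednK //; lia.
have bc : b <= c by apply: minb.
have Er : s n.+1 b = (s n.+1 b.-1).+1.
  have [] := up b.-1 ltac:(lia).
  rewrite prednK // => /andP[l1 l2] _.
  by have := minb b.-1; rewrite -Eb; case: eqVneq => [E /(_ isT)|]; lia.
exists b.-1; first lia.
move=> d bdc; rewrite -Er.
have := mono d b; have := mono c d; lia.
Qed.

Variable r : nat.
Hypotheses (rc : r < c) (rise : forall b, r < b <= c -> s n.+1 b = (s n.+1 r).+1).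

(* The statistic of the placement left when the last column and row [r] are
   deleted. *)
Definition reduced a b :=
  if a < n then s a b.+1 else if b <= r then s n.+1 b else s n (maxn c b.+1).

Lemma rise_last : s n.+1 r <= s n c <= (s n.+1 r).+1.
Proof.
have [rs us _ e0 dg] := cs.
have [/andP[+ +] _] := rs n (ltnSn n); rewrite -/c rise; lia.
Qed.

Lemma reduced_shift a b : a <= n -> h a <= b.+1 -> reduced a b = s a b.+1.
Proof.
have [h0 hh hz] := bd; have [rs us _ e0 dg] := cs.
rewrite /reduced; case: ltnP => // na an; have {na an} Ea : a = n by lia.
subst a => cb; have -> : maxn c b.+1 = b.+1 by rewrite /c; lia.
(* The branches of [reduced] could disagree only at [b = r = c - 1], where the unit diagonal from
   [(n, c)] to [(n + 1, r)] forces the two values to be equal. *)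
case: leqP => // br; have [-> Ec] : b = r /\ r.+1 = c by move: rc cb br; rewrite /c; lia.
have hn2 : h n.+1 = 0 by apply/eqP; rewrite hz.
have := rise_last; suff : s n c <= s n.+1 r by rewrite Ec; lia.
apply: dg; rewrite /= ?hn2; rewrite -/c; try lia.
by move=> i ia; have -> : i = n; rewrite /c; lia.
Qed.

(** Where [reduced_shift] applies, the conditions are those of [s] one row higher. Lower down on the
    new last vertical line, [board_conditions_gt0] gives positivity and [board_conditions_above] the
    diagonals that end above row [r]. *)
Lemma reduced_conditions : board_conditions n h' reduced.
Proof.
have bd' : board n h' := board_remove bd removable.
have [h0 hh hz] := bd; have [rs us s0 e0 dg] := cs.
have cn i : i <= n -> c <= h i by apply: hh.
have c0 : 0 < c by lia.
have hn2 : h n.+1 = 0 by apply/eqP; rewrite hz.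
have hE i : i < n -> h' i = (h i).-1 by rewrite /h' /remove_last => ->.
have hn : h' n = 0 by rewrite /h' /remove_last ltnn.
have h1 i : i < n -> h i = (h' i).+1 by move=> lt; rewrite hE //; have := cn i; lia.
have pos b : 0 < b -> maxn c b.+1 <= h n.-1 -> 0 < s n (maxn c b.+1).
  by move=> b0 bh; apply: (board_conditions_gt0 bd cs); rewrite -?/c; lia.
split.
- move=> a an; have ha := hh a a.+1 (leqnSn a); have E := h1 a an.
  by rewrite !reduced_shift -?E //; [apply: rs|..]; lia.
- move=> a b an /andP[hb bh].
  have a0 : 0 < a by case: a bh hb {an} => //=; lia.
  have hb' : b.+1 < h a.-1 by rewrite (h1 a.-1) //; lia.
  case: (ltnP a n) => [lt|na].
    have E := h1 a lt; rewrite !reduced_shift; try lia.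
    by apply: us; lia.
  have Ea : a = n by lia.
  subst a; have cn1 : c <= h n.-1 by apply: cn; lia.
  have -> : reduced n b.+1 = if b < r then s n.+1 b.+1 else s n (maxn c b.+2).
    by rewrite /reduced ltnn.
  case: (ltnP b r) => br.
    rewrite /reduced ltnn (ltnW br).
    by apply: us => //; rewrite hn2 /= -/c; lia.
  have p0 : 0 < s n (maxn c b.+2) by apply: pos; lia.
  split=> //; case: (leqP b.+2 c) => bc.
    rewrite /reduced ltnn; case: (leqP b r) => br'.
      (* The two branches of [reduced] meet at height [r], and [rise_last] bounds the step between
         them. *)
      by have -> : b = r; [lia | apply: rise_last].
    by have -> : maxn c b.+1 = c; lia.
  rewrite reduced_shift //.
  by have [] := us n b.+1 (leqnSn n) ltac:(rewrite -/c; lia).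
- rewrite /reduced; case: (posnP n) => [n0|//].
  by move: e0; rewrite n0.
- by rewrite /reduced ltnn leq0n.
move=> a a' b' aa' hb' sum above.
have E := h1 a ltac:(lia).
have above' i : a <= i < a' -> a + h a <= i + h i.
  by move=> ia; have := above i ia; have := h1 i; lia.
have E' := h1 a'.-1 ltac:(lia).
have shift : reduced a (h' a) = s a (h a).
  by rewrite reduced_shift ?E //; lia.
case: (leqP (h a') b'.+1) => hab.
  by rewrite shift reduced_shift //; try lia; apply: dg => //; lia.
have {hab aa'} [an Ea bc] : [/\ a < n, a' = n & b'.+1 < c].
  case: (ltngtP a' n) => [/h1|gt|Ea]; [lia|lia|].
  by split; rewrite // -?Ea /c -?Ea; lia.
(* Up to height [r] the diagonal prolongs to one of the larger board, ending at [(n + 1, b')]. Above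
   [r] the value is that of [(n, c)], a point above the antidiagonal. *)
subst a'; rewrite shift /reduced ltnn; case: (leqP b' r) => br.
  apply: dg => [|||i ia]; rewrite ?hn2 /= -/c; try lia.
  by have [->|ne] := eqVneq i n; [rewrite -/c | have := above' i]; lia.
have -> : maxn c b'.+1 = c by lia.
have cn1 := cn n.-1 (leq_pred n).
apply: (board_conditions_above bd cs) => [|||i ia]; rewrite -?/c; try lia.
by apply: above'; lia.
Qed.

End Step.

Lemma sufficiency n h s : board n h -> board_conditions n h s ->
  exists p, [/\ placement n h p, avoids231 n h p &
    forall a b, a <= n -> h a <= b <= h a.-1 -> lis p a b = s a b].
Proof.
elim: n h s => [|n IH] h s bd cs.
  have hz i : h i = 0 by apply/eqP; rewrite (board_eq0 bd).
  exists id; split=> [||a b]; first by split.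
    by move=> i j k _.
  by rewrite !hz => a0 b0; have [-> ->] : a = 0 /\ b = 0 by [lia]; rewrite (start0 cs).
have [r rc rise] := last_rise bd cs.
have bd' := board_remove bd (removable bd cs).
have cs' := reduced_conditions bd cs rc rise.
have shift := reduced_shift bd cs rc rise.
have [q [[ltq injq] avq lisq]] := IH _ _ bd' cs'.
have [h0 hh hz] := bd; have [rs us s0 e0 dg] := cs.
set c := h n in rc rise.
have cn i : i <= n -> c <= h i by apply: hh.
have hE i : i < n -> remove_last n h i = (h i).-1 by rewrite /remove_last => ->.
have hn : remove_last n h n = 0 by rewrite /remove_last ltnn.
(* Row [r] is reopened and receives the marker of the new last column. *)
pose p i := if i < n then bump r (q i) else r.
have pE i : i < n -> p i = bump r (q i) by rewrite /p => ->.
have pn : p n = r by rewrite /p ltnn.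
have lisp a b : a <= n -> lis p a (bump r b) = lis q a b.
  by move=> an; rewrite (@lis_bump p q r) // => i ia; apply: pE; lia.
have ltq' i : i < n -> (q i).+1 < h i.
  by move=> lt; have := ltq i lt; rewrite hE //; lia.
have c0 : 0 < c by lia.
have lis_row b : b < c -> lis q n b = reduced n h s r n b.
  move=> bc; apply: lisq => //; rewrite hn /=.
  case: (posnP n) => [n0|n0]; last first.
    by rewrite hE; [have := cn n.-1 (leq_pred n) | ]; lia.
  have -> : n.-1 = n by rewrite n0.
  by move: bc; rewrite hn /c {1}n0 h0 n0; lia.
have lis_r : lis q n r = s n.+1 r by rewrite lis_row // /reduced ltnn leqnn.
have lis_high b : r < b < c -> lis q n b = s n c.
  move=> /andP[rb bc]; rewrite lis_row // /reduced ltnn leqNgt rb /= -/c.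
  by congr s; lia.
have pr i : i < n -> p i != r by move=> lt; rewrite pE // eq_sym neq_bump.
exists p; split.
- split=> [i|i j].
    rewrite ltnS leq_eqVlt => /predU1P[->|lt]; first by rewrite pn.
    by rewrite pE //; have := ltq' i lt; rewrite /bump; lia.
  rewrite !inE !ltnS => ni nj E.
  have [Ei|nei] := eqVneq i n; have [Ej|nej] := eqVneq j n; first by rewrite Ei.
  + by have := pr j; rewrite -E Ei pn eqxx; lia.
  + by have := pr i; rewrite E Ej pn eqxx; lia.
  by move: E; rewrite !pE; [move=> /(can_inj (bumpK r)); apply: injq; rewrite inE| |]; lia.
- move=> i j k ijk; rewrite ltnS leq_eqVlt => /predU1P[Ek|lt] pijk pjh; last first.
    apply: (avq i j k) => //; move: pijk pjh; rewrite !pE ?hE //; try lia.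
    + by rewrite /bump; lia.
    + by have := cn k (ltnW lt); rewrite /bump; lia.
  (* A 231 ending in the new marker: avoidance by [q] keeps all markers from column [j] on at or
     above [q i] ([right]), while the chain ending in column [j] stays below [s n c] ([top]). *)
  move: pijk pjh; rewrite Ek pn !pE; try lia.
  rewrite -/c => pij pjc.
  have [riq qij qjc] : [/\ r <= q i, q i < q j & (q j).+1 < c].
    by move: pij pjc; rewrite /bump; split; lia.
  have right k' : j <= k' < n -> q i <= q k'.
    move=> jk; rewrite leqNgt; apply/negP => lt.
    have [E|ne] := eqVneq j k'; first by move: lt; rewrite -E; lia.
    by apply: (avq i j k'); rewrite ?hE; have := cn k'; lia.
  have top : lis q j (q j) < s n c.
    by rewrite -(lis_high c.-1) //; [apply: lis_lt|]; lia.
  (* With equality, a longest chain below row [r] lies entirely before column [j], and the marker of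
     [j] would extend it beyond [s n c]. *)
  have [E|ne] := eqVneq (s n c) (s n.+1 r).
    suff : s n.+1 r <= lis q j (q j) by lia.
    rewrite -lis_r (@eq_lis_columns q j) => [||k' jk]; [apply: lis_homo; lia|lia|].
    by have := right k' jk; lia.
  (* Otherwise the value rises exactly at row [r] of [q], so the marker of that row ends a longest
     chain. It lies before column [j], and the marker of [j] extends that chain too far. *)
  have [|u [un qu]] := @lis_row_attained q n r injq.
    by rewrite lis_r lis_high; have := rise_last cs rc rise; rewrite -/c; lia.
  rewrite lis_r => le; have [ju|uj] := leqP j u.
    have E : q i = q u by have := right u; lia.
    by have := injq i u; rewrite !inE => /(_ _ _ E); lia.
  have : lis q u (q u) < lis q j (q j) by apply: lis_lt; lia.
  by rewrite qu; have := rise_last cs rc rise; rewrite -/c; lia.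
move=> a b; rewrite leq_eqVlt => /predU1P[->|an] hb.
  have hn2 : h n.+1 = 0 by apply/eqP; rewrite hz.
  have bc : b <= c by move: hb => /=; rewrite -/c; lia.
  (* Row [r] is empty in the columns before [n], so the bounds [r] and [bump r r = r.+1] see the
     same markers. *)
  rewrite /= pn (@eq_lis_rows p n r (bump r r)); last first.
    by move=> i /pr; rewrite /bump; lia.
  rewrite lisp // lis_r; case: (ltnP r b) => rb.
    have {1}-> : b = bump r b.-1 by rewrite /bump; lia.
    rewrite lisp // (rise b); last lia.
    have [<-|ne] := eqVneq r b.-1; first by rewrite lis_r; lia.
    by rewrite lis_high; [have := rise_last cs rc rise; rewrite -/c|]; lia.
  rewrite (@eq_lis_rows p n b (bump r b)); last first.
    by move=> i /pr; rewrite /bump; lia.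
  by rewrite lisp // lis_row /reduced ?ltnn ?rb; lia.
have ca := cn a an.
have {1}-> : b = bump r b.-1 by rewrite /bump; lia.
rewrite lisp // lisq //.
  by rewrite shift // prednK //; lia.
case: (posnP a) hb => [->|a0] hb.
  by rewrite /remove_last; move: hb; rewrite /=; case: ifP; rewrite ?h0; lia.
rewrite (hE a.-1); last lia.
by rewrite /remove_last; case: ifP; lia.
Qed.

(** * Boards, borders and transposition *)

Definition swap (A B : Type) (x : A * B) : B * A := (x.2, x.1).

Lemma swapK A B : cancel (@swap A B) (@swap B A).
Proof. by case. Qed.

Section Boards.
Variable m : nat.
Implicit Types (F P Q : {set square m}) (V : vertex).

Definition transpose F : {set square m} := [set x | swap x \in F].

Lemma transposeK : involutive transpose.
Proof. by move=> F; apply/setP => x; rewrite !inE swapK. Qed.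

Lemma has_squareP F i j :
  reflect (exists2 x : square m, x \in F & x.1 = i :> nat /\ x.2 = j :> nat) (has_square F i j).
Proof.
apply: (iffP existsP) => [[x /and3P[xF /eqP <- /eqP <-]]|[x xF [<- <-]]]; exists x => //.
by rewrite xF !eqxx.
Qed.

Lemma mem_has_square F (x : square m) : (x \in F) = has_square F x.1 x.2.
Proof.
apply/idP/has_squareP => [xF|[[i j] + [Ei Ej]]]; first by exists x.
by case: x Ei Ej => i' j' /= /val_inj -> /val_inj ->.
Qed.

Lemma has_square_transpose F i j : has_square (transpose F) i j = has_square F j i.
Proof.
by apply/has_squareP/has_squareP => -[x xF [<- <-]]; exists (swap x); rewrite ?inE ?swapK // in xF *.
Qed.

Lemma has_square_lt F i j : has_square F i j -> i < m /\ j < m.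
Proof. by case/has_squareP => x _ [<- <-]. Qed.

Lemma ferrersP F : ferrers F <-> forall i j i' j',
  i' <= i -> j' <= j -> has_square F i j -> has_square F i' j'.
Proof.
split=> [hF i j i' j' ii jj /has_squareP[x xF [Ei Ej]]|dn V /existsP[x /and3P[xF h1 h2]]].
  have /hF/subsetP s : is_vertex F (i.+1, j.+1).
    by apply/existsP; exists x; rewrite xF -Ei -Ej !eqxx !orbT.
  have [im jm] : i' < m /\ j' < m by have := ltn_ord x.1; have := ltn_ord x.2; lia.
  by have := s (Ordinal im, Ordinal jm); rewrite inE /= !ltnS ii jj mem_has_square => /(_ isT).
apply/subsetP => y; rewrite inE => /andP[y1 y2]; rewrite mem_has_square.
rewrite mem_has_square in xF; apply: dn xF; lia.
Qed.

Lemma ferrers_transpose F : ferrers F -> ferrers (transpose F).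
Proof.
move=> /ferrersP dn; apply/ferrersP => i j i' j' ii jj.
by rewrite !has_square_transpose; apply: dn.
Qed.

(** The index may exceed the array; such columns get height 0. *)
Definition height F i := find (fun j => ~~ has_square F i j) (iota 0 m).

Lemma height_le F i : height F i <= m.
Proof. by rewrite -[leqRHS](size_iota 0) find_size. Qed.

Lemma has_squareE F : ferrers F -> forall i j, has_square F i j = (j < height F i).
Proof.
move=> /ferrersP dn i j; apply/idP/idP => [hij|lt].
  rewrite ltnNge; apply/negP => le.
  have [_ jm] := has_square_lt hij.
  have lt : height F i < m by lia.
  have : has (fun j => ~~ has_square F i j) (iota 0 m) by rewrite has_find size_iota.
  move=> /(nth_find 0); rewrite nth_iota //= => /negP; apply.
  exact: dn hij.
have := before_find 0 lt; rewrite nth_iota ?add0n ?(leq_trans lt (height_le _ _)) //.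
by move/negbFE.
Qed.

Lemma card_column F (i : 'I_m) : ferrers F -> #|column F i| = height F i.
Proof.
move=> hF.
have -> : column F i = [set (i, j) | j in [set j : 'I_m | j < height F i]].
  apply/setP => -[i' j]; rewrite !inE /=; apply/andP/imsetP.
    move=> [xF /eqP Ei]; exists j; last by rewrite Ei.
    by rewrite inE -Ei -has_squareE // -(mem_has_square F (i', j)).
  move=> [j']; rewrite inE -has_squareE // => hj [-> ->].
  by rewrite eqxx mem_has_square.
rewrite card_imset => [|j j' []//]; rewrite -sum1_card.
under eq_bigl do rewrite inE.
by rewrite -(big_ord_widen m (fun=> 1)) ?height_le // sum1_card card_ord.
Qed.

Lemma longest_columnE F : ferrers F -> longest_column F = height F 0.
Proof.
move=> hF; apply/eqP; rewrite eqn_leq; apply/andP; split.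
  apply/bigmax_leqP => i _; rewrite card_column // leqNgt; apply/negP => lt.
  move: (lt); rewrite -has_squareE // => /(proj1 (ferrersP F) hF i _ 0 (height F 0)).
  by rewrite has_squareE // ltnn => /(_ isT (leqnn _)).
case: (posnP m) => m0; first by have := height_le F 0; lia.
by rewrite -(card_column (Ordinal m0)) // (leq_bigmax (Ordinal m0)).
Qed.

Lemma card_column_transpose F (i : 'I_m) : #|column (transpose F) i| = #|row F i|.
Proof.
rewrite -(card_imset _ (can_inj (@swapK 'I_m 'I_m))); congr #|pred_of_set _|.
apply/setP => x; rewrite !inE; apply/imsetP/andP => [[y]|[xF xi]].
  by rewrite !inE => /andP[yF yi] ->.
by exists (swap x); rewrite ?swapK // !inE swapK xF.
Qed.

Lemma card_row_transpose F (i : 'I_m) : #|row (transpose F) i| = #|column F i|.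
Proof. by rewrite -card_column_transpose transposeK. Qed.

Lemma longest_column_transpose F : longest_column (transpose F) = longest_row F.
Proof. by apply: eq_bigr => i _; rewrite card_column_transpose. Qed.

Lemma longest_row_transpose F : longest_row (transpose F) = longest_column F.
Proof. by rewrite -longest_column_transpose transposeK. Qed.

Lemma board_height F : ferrers F -> longest_row F = longest_column F ->
  board (longest_column F) (height F).
Proof.
move=> hF hl; have dn := proj1 (ferrersP F) hF; split.
- by rewrite -longest_columnE.
- move=> i j ij; rewrite leqNgt; apply/negP => lt.
  by move: (lt); rewrite -has_squareE // => /(dn _ _ _ _ ij (leqnn _)); rewrite has_squareE // ltnn.
move=> i; rewrite -hl -longest_column_transpose longest_columnE; last exact: ferrers_transpose.
by rewrite leqNgt -has_squareE ?has_square_transpose ?has_squareE -?eqn0Ngt //; apply: ferrers_transpose.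
Qed.
End Boards.

(** * The border as a lattice path *)

Section Border.
Variables (n : nat) (h : nat -> nat).
Hypothesis bd : board n h.

(** The border meets a vertical line in the segment between the heights of the two adjacent columns.
    For [V.1 = 0] the truncated predecessor reduces it to the point [(0, h 0)]. *)
Definition on_border (V : vertex) := [&& V.1 <= n, h V.1 <= V.2 & V.2 <= h V.1.-1].

(** Every step goes right or down and raises [V.1 - V.2] by one, so this difference determines the
    vertex and, shifted by [n], its index. *)
Lemma on_border_inj V W : on_border V -> on_border W ->
  V.1 + W.2 = W.1 + V.2 -> V = W.
Proof.
have [h0 hh hz] := bd.
case: V W => [a b] [c d] /= /and3P[/= an ab ba] /and3P[/= cn cd dc] /= E.
case: (ltngtP a c) => ac.
- by have le : h c.-1 <= h a; [apply: hh | exfalso]; lia.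
- by have le : h a.-1 <= h c; [apply: hh | exfalso]; lia.
by have [-> ->] : a = c /\ b = d by lia.
Qed.

Lemma on_border_right a b : on_border (a, b) -> on_border (a.+1, b) -> a < n /\ b = h a.
Proof. by move=> /and3P[/= _ ? _] /and3P[/= *]; split=> //; apply/eqP; rewrite eqn_leq; apply/andP. Qed.

Definition path_step (V : vertex) : vertex :=
  if (0 < V.2) && (V.2.-1 < h V.1) then (V.1.+1, V.2) else (V.1, V.2.-1).

Lemma path_stepP V : on_border V -> V <> (n, 0) ->
  on_border (path_step V) /\
  (V.1 < n /\ V.2 = h V.1 /\ path_step V = (V.1.+1, V.2) \/
   V.2 = V.2.-1.+1 /\ h V.1 < V.2 /\ path_step V = (V.1, V.2.-1)).
Proof.
have [h0 hh hz] := bd.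
case: V => a b /= /and3P[/= an ab ba] ne; rewrite /path_step /=.
case: ifP => [/andP[b0 bh]|].
  have Eb : b = h a by lia.
  have ha := hz a; have := hh a a.+1.
  have lt : a < n by lia.
  split; last by left; rewrite lt Eb.
  by rewrite /on_border /= lt Eb leqnn !andbT; apply: hh.
move=> nbh; have hb : h a < b.
  rewrite ltn_neqAle ab andbT; apply/eqP => E; apply: ne.
  by have ha := hz a; have [-> ->] : a = n /\ b = 0 by lia.
by split; [rewrite /on_border /=; lia | right; split; [lia | split]].
Qed.

Lemma iter_path_step k : k <= n + n ->
  let V := iter k path_step (0, n) in on_border V /\ V.1 + n = V.2 + k.
Proof.
have [h0 hh hz] := bd.
elim: k => [|k IH] kn; first by rewrite /on_border /= h0 leqnn; lia.
have [|/= bV EV] := IH; first by lia.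
rewrite -/(iter k _ _); set V := iter k path_step _ in bV EV *.
have [|bV' st] := path_stepP bV; first by move=> E; rewrite E /= in EV; lia.
split=> //=; have /and3P[_ _ _] := bV; case: st => [[_ [_ ->]]|[? [_ ->]]] /=; lia.
Qed.

Lemma iter_path_stepE V : on_border V ->
  V.2 <= V.1 + n /\ V.1 + n - V.2 <= n + n /\ iter (V.1 + n - V.2) path_step (0, n) = V.
Proof.
have [h0 hh hz] := bd.
move=> bV; have /and3P[Vn hV Vh] := bV; have := hh 0 V.1.-1 (leq0n _).
rewrite h0 => hn; have le : V.2 <= V.1 + n by lia.
split=> //; have k2 : V.1 + n - V.2 <= n + n by lia.
split=> //; have [bW EW] := iter_path_step k2.
by apply: on_border_inj => //; lia.
Qed.

End Border.

(** A form invariant under transposition: the square up and right of [V] is missing, the one down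
    and left is present, and on the axes only the two endpoints remain. *)
Lemma on_borderE n h V : board n h -> on_border n h V =
  (h V.1 <= V.2) &&
    (if (V.1 == 0) || (V.2 == 0) then V.1 + V.2 == n else V.2.-1 < h V.1.-1).
Proof.
case: V => a b [h0 hh hz]; rewrite /on_border /=.
case: a => [|a]; first by rewrite /= h0; lia.
case: b => [|b] /=; first by rewrite leqn0 hz; lia.
rewrite andbCA; congr andb; apply/andP/idP => [[]//|lt]; split=> //.
by rewrite ltnNge -hz; lia.
Qed.

Section BorderOfBoard.
Variables (m : nat) (F : {set square m}).
Hypotheses (hF : ferrers F) (hl : longest_row F = longest_column F).

Let n := longest_column F.
Let h := height F.
Let bd : board n h := board_height hF hl.

Lemma border_stepE : border_step F =1 path_step h.
Proof. by move=> V; rewrite /border_step has_squareE. Qed.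

Lemma size_border : size (border F) = (n + n).+1.
Proof. by rewrite size_traject hl. Qed.

Lemma nth_border V k : k <= n + n -> nth V (border F) k = iter k (path_step h) (0, n).
Proof.
move=> kn; rewrite (set_nth_default (0, n)) ?size_border //.
by rewrite nth_traject ?hl // (eq_iter border_stepE).
Qed.

Lemma mem_border V : (V \in border F) = on_border n h V.
Proof.
apply/trajectP/idP => [[k]|bV].
  rewrite hl ltnS => kn ->; rewrite (eq_iter border_stepE).
  by have [] := iter_path_step bd kn.
have [_ [kn E]] := iter_path_stepE bd bV.
by exists (V.1 + n - V.2); rewrite ?(eq_iter border_stepE) ?E // hl ltnS.
Qed.

Lemma uniq_border : uniq (border F).
Proof.
apply/(uniqP (0, 0)) => i j; rewrite !inE size_border !ltnS => ni nj.
rewrite !nth_border // => E.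
have [_ Ei] := iter_path_step bd ni; have [_ Ej] := iter_path_step bd nj.
by move: Ei; rewrite E; lia.
Qed.

Lemma index_border V : V \in border F -> index V (border F) = V.1 + n - V.2.
Proof.
rewrite mem_border => bV; have [_ [kn E]] := iter_path_stepE bd bV.
by rewrite -{1}E -(nth_border V kn) index_uniq ?size_border ?uniq_border.
Qed.

Lemma end_border : (n, 0) \in border F.
Proof. by rewrite mem_border on_borderE //= leqn0 (board_eq0 bd) orbT addn0 leqnn eqxx. Qed.

Definition step_conditions (s : vertex -> nat) : Prop :=
  [/\ s (0, n) = 0, s (n, 0) = 0
    & forall V1 V2, V1 \in border F -> V2 \in border F ->
        directly_left V1 V2 \/ directly_below V1 V2 ->
        s V1 <= s V2 <= (s V1).+1 /\ 0 < s V2].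

Lemma step_conditionsE S : is_Fsequence F S ->
  (monotonicity_conditions F S /\ zero_conditions S) <->
  step_conditions (value_at F S).
Proof.
move=> szS; have sz : size S = (n + n).+1 by rewrite szS size_border.
have nthE k : k <= n + n -> nth 0 S k = value_at F S (iter k (path_step h) (0, n)).
  move=> kn; rewrite -(nth_border (0, 0)) // /value_at index_uniq ?uniq_border //.
  by rewrite size_border.
have headE : head 0 S = value_at F S (0, n).
  by rewrite -nth0 nthE.
have lastE : last 0 S = value_at F S (n, 0).
  by rewrite -nth_last sz /= /value_at index_border ?end_border //= subn0.
split=> [[mono [z0 z1 nz]]|[z0 z1 st]].
  rewrite /step_conditions -/n -headE -lastE; split=> // -[a b] V2 b1 b2 adj.
  have /andP[le1 le2] := mono _ V2 b1 b2 adj; split; first by rewrite le1.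
  rewrite lt0n; apply/eqP => E2; have E1 : value_at F S (a, b) = 0 by lia.
  move: E1 E2; rewrite /value_at !index_border //.
  have [l1 [k1 _]] := iter_path_stepE bd (etrans (esym (mem_border _)) b1).
  have [l2 [k2 _]] := iter_path_stepE bd (etrans (esym (mem_border _)) b2).
  rewrite /= in l1 k1.
  (* A rightward step runs from [V1] to [V2], a downward one from [V2] to [V1]; the index passed to
     [nz] is that of the earlier vertex. *)
  case: adj => E; rewrite E /= in l2 k2 * => E1 E2.
    apply: (nz (a + n - b)); first by rewrite sz; lia.
    by split=> //; rewrite -E2; congr nth; lia.
  apply: (nz (a + n - b.+1)); first by rewrite sz; lia.
  by split=> //; rewrite -E1; congr nth; lia.
split; first by move=> V1 V2 b1 b2 /(st V1 V2 b1 b2)[].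
rewrite /zero_conditions headE lastE; split=> // k.
rewrite sz ltnS => kn; rewrite !nthE ?(ltnW kn) // => -[].
have [b1 E1] := iter_path_step bd (ltnW kn); have [b2 _] := iter_path_step bd kn.
move: b1 b2 E1; rewrite iterS; set V := iter k _ _ => b1 b2 E1 v1 v2.
have [|_ adj] := path_stepP bd b1; first by move=> E; rewrite E /= in E1; lia.
rewrite -!mem_border in b1 b2.
case: adj => [[_ [_ E]]|[EV [_ E]]].
  by have [|_] := st V _ b1 b2; [left | rewrite v2].
have [|_] := st _ V b2 b1; last by rewrite v1.
by right; rewrite /directly_below E /= -EV; case: (V).
Qed.

(** The first square of the diagonal forces [V1] to the top of its column; the others say that no
    column in between drops below the antidiagonal. *)
Lemma diagonal_inP V1 V2 : V1 \in border F -> V2 \in border F ->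
  diagonal_in F V1 V2 <->
  [/\ V1.1 < V2.1, V1.1 + V1.2 = V2.1 + V2.2, V1.2 = h V1.1
    & forall i, V1.1 <= i < V2.1 -> V1.1 + h V1.1 <= i + h i].
Proof.
case: V1 V2 => [a b] [c d]; rewrite !mem_border => /and3P[/= n1 h1 _] /and3P[/= n2 h2 _].
split=> [[k [k0 [/= E1 E2]] sq]|[lt E Eh above]].
  have Eh : b = h a by have := sq 0 k0; rewrite has_squareE //= addn0 -/h; lia.
  split=> //; try lia.
  by move=> i ia; have := sq (i - a); rewrite has_squareE //= -/h subnKC; lia.
exists (c - a) => [|i ik] /=; first by lia.
by rewrite has_squareE // -/h; have := above (a + i); lia.
Qed.

Lemma board_conditionsP (s : vertex -> nat) :
  (step_conditions s /\ (forall V1 V2, V1 \in border F -> V2 \in border F ->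
     diagonal_in F V1 V2 -> s V1 <= s V2)) <->
  board_conditions n h (fun a b => s (a, b)).
Proof.
have [h0 hh hz] := bd.
split=> [[[z0 z1 st] dg]|[rs us z0 z1 dg]].
  split=> //.
  - move=> a an; apply: st; rewrite ?mem_border /on_border /=; last by left.
      by rewrite ltnW ?leqnn ?hh ?leq_pred.
    by rewrite an leqnn hh.
  - move=> a b an /andP[ab ba]; apply: st; rewrite ?mem_border /on_border /=; last by right.
      by rewrite an ab ltnW.
    by rewrite an ba leqW.
  move=> a a' b' /andP[aa an] hb' E above.
  have b1 : (a, h a) \in border F.
    by rewrite mem_border /on_border /= leqnn hh ?leq_pred //; lia.
  have b2 : (a', b') \in border F by rewrite mem_border /on_border /= an.
  by apply: dg => //; apply/diagonal_inP.
split.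
  split=> // V1 V2; rewrite !mem_border => b1 b2 adj.
  case: V1 b1 adj => a b b1 [] E; rewrite E /= in b2 *.
    by have [an ->] := on_border_right b1 b2; apply: rs.
  by apply: us; move: b1 b2 => /and3P[/= an ab _] /and3P[/= _ _ ba]; rewrite ?ab.
move=> [a b] [a' b'] b1 b2 /(diagonal_inP b1 b2)[/= lt E Eb above].
rewrite mem_border in b2; have /and3P[/= n2 h2 h2'] := b2.
by rewrite Eb; apply: dg => //; [rewrite lt | rewrite h2 | rewrite -Eb].
Qed.

End BorderOfBoard.

(** The reflection exchanges the two ends of a diagonal, hence the reversed inequality for 312. *)
Lemma diagonal_in_transpose m (F : {set square m}) V1 V2 :
  diagonal_in F V1 V2 -> diagonal_in (transpose F) (swap V2) (swap V1).
Proof.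
move=> [k [k0 [E1 E2]] sq]; exists k => // i ik.
rewrite has_square_transpose /=.
have := sq (k - i.+1) ltac:(lia).
by have -> : V1.1 + (k - i.+1) = V2.1 - i.+1; [lia | have -> : V1.2 - (k - i.+1).+1 = V2.2 + i; [lia|]].
Qed.

(** * Transposing the border *)

Section Transpose.
Variables (m : nat) (F : {set square m}).
Hypotheses (hF : ferrers F) (hl : longest_row F = longest_column F).

Lemma longest_transpose : longest_row (transpose F) = longest_column (transpose F).
Proof. by rewrite longest_row_transpose longest_column_transpose. Qed.

Let hF' := ferrers_transpose hF.
Let hl' := longest_transpose.

Lemma mem_border_transpose V : (V \in border (transpose F)) = (swap V \in border F).
Proof.
rewrite !mem_border // !on_borderE; try exact: board_height.
rewrite longest_column_transpose hl /= orbC addnC.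
rewrite leqNgt -has_squareE // has_square_transpose has_squareE // -leqNgt.
by rewrite -has_squareE // has_square_transpose has_squareE.
Qed.

Lemma step_conditions_transpose s :
  step_conditions F s -> step_conditions (transpose F) (s \o @swap nat nat).
Proof.
move=> [z0 z1 st]; rewrite /step_conditions longest_column_transpose hl; split=> // V1 V2.
rewrite !mem_border_transpose => b1 b2 adj; apply: st => //.
by case: adj => ->; [right | left].
Qed.

End Transpose.
(** * Placements *)

Section Patterns.
Variable m : nat.
Implicit Types (F P Q : {set square m}) (V : vertex).

Definition col_lt : rel (square m) := fun x y => x.1 < y.1.

Lemma col_lt_trans : transitive col_lt.
Proof. by move=> y x z; apply: ltn_trans. Qed.

Definition squares_by_column Q : seq (square m) :=
  [seq (i, j) | i <- enum 'I_m, j <- [seq j <- enum 'I_m | (i, j) \in Q]].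

Lemma heightsE Q : heights Q = [seq val x.2 | x <- squares_by_column Q].
Proof. by rewrite /squares_by_column map_allpairs. Qed.

Lemma mem_squares_by_column Q x : (x \in squares_by_column Q) = (x \in Q).
Proof.
apply/allpairsPdep/idP => [[i [j [_ + ->]]]|xQ].
  by rewrite mem_filter => /andP[].
case: x xQ => i j ijQ; exists i, j; split=> //; first exact: mem_enum.
by rewrite mem_filter ijQ mem_enum.
Qed.

Lemma sorted_squares_by_column Q :
  {in Q &, forall x y, x.1 = y.1 -> x = y} -> sorted col_lt (squares_by_column Q).
Proof.
move=> inj; rewrite (sorted_pairwise col_lt_trans) /squares_by_column.
have : pairwise ltn [seq val i | i <- enum 'I_m].
  by rewrite val_enum_ord -(sorted_pairwise ltn_trans) iota_ltn_sorted.
elim: {1 3}(enum 'I_m) => //= i s IH /andP[ai /IH ps].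
rewrite pairwise_cat ps andbT; apply/andP; split.
  apply/allrelP => x y /mapP[j _ ->] /allpairsPdep[i' [j' [si' _ ->]]].
  by apply: (allP ai); apply: map_f.
have : all (fun j => (i, j) \in Q) [seq j <- enum 'I_m | (i, j) \in Q] by apply: filter_all.
have : uniq [seq j <- enum 'I_m | (i, j) \in Q] by rewrite filter_uniq ?enum_uniq.
case: [seq _ <- _ | _] => [|a [|b t]] //=.
rewrite inE negb_or => /and3P[/andP[/eqP ab _] _ _] /and3P[aQ bQ _].
by have [] : (i, a) = (i, b) by apply: inj.
Qed.

(** A strictly sorted list is determined by its elements, so [t] is the enumeration of [Q] filtered
    by membership in [t]. *)
Lemma subseq_squares_by_column Q t :
  {in Q &, forall x y, x.1 = y.1 -> x = y} ->
  subseq t (squares_by_column Q) = all (mem Q) t && sorted col_lt t.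
Proof.
move=> /sorted_squares_by_column so; apply/idP/andP => [sub|[/allP tQ st]].
  split; last exact: subseq_sorted col_lt_trans _ _ sub so.
  by apply/allP => x /(mem_subseq sub); rewrite mem_squares_by_column.
suff -> : t = [seq x <- squares_by_column Q | x \in t] by apply: filter_subseq.
have irr : irreflexive col_lt by move=> x; apply: ltnn.
apply: (irr_sorted_eq col_lt_trans irr) => //.
  by apply: sorted_filter so; apply: col_lt_trans.
move=> x; rewrite mem_filter mem_squares_by_column andb_idr //.
exact: tQ.
Qed.

(** Strictness needs only [y] in the list: it counts towards its own rank and not towards that of a
    smaller [x]. *)
Lemma standardize_lt (s : seq nat) x y : y \in s ->
  (count (fun z => z <= x) s < count (fun z => z <= y) s) = (x < y).
Proof.
move=> ys; case: (ltnP x y) => [xy|yx]; last first.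
  by rewrite ltnNge; apply/negbTE/negPn/sub_count => z zy; apply: leq_trans zy yx.
have /permP pe := perm_to_rem ys; rewrite !pe /= leqnn (leqNgt y) xy /= add0n add1n ltnS.
by apply: sub_count => z zx; apply: leq_trans zx (ltnW xy).
Qed.

Lemma avoids_perm_of_rect Q tau : {in Q &, forall x y, x.1 = y.1 -> x = y} ->
  avoids tau (standardize (heights Q)) <->
  ~ exists2 t : seq (square m), all (mem Q) t && sorted col_lt t
      & order_isomorphic [seq val x.2 | x <- t] tau.
Proof.
move=> inj; rewrite /avoids /standardize heightsE -map_comp.
set g := _ \o _; have gE t : {subset t <= squares_by_column Q} ->
    order_isomorphic (map g t) tau <-> order_isomorphic [seq val x.2 | x <- t] tau.
  move=> tQ; rewrite /order_isomorphic !size_map.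
  have E i j : i < size t -> j < size t -> (nth 0 (map g t) i < nth 0 (map g t) j) =
      (nth 0 [seq val x.2 | x <- t] i < nth 0 [seq val x.2 | x <- t] j).
    case: t tQ => // x0 t tQ it jt; rewrite !(nth_map x0) // /g /= standardize_lt //.
    by apply/mapP; exists (nth x0 (x0 :: t) j) => //; apply/tQ/mem_nth.
  split=> -[sz H]; split=> // i j it jt; first by rewrite -E ?H.
  by rewrite E ?H.
split=> nex [t].
  rewrite -subseq_squares_by_column // => sub iso; apply: nex; exists (map g t).
    exact: map_subseq.
  by apply/gE => //; apply: mem_subseq.
case/subseqP => b szb ->; rewrite -map_mask => iso; apply: nex.
exists (mask b (squares_by_column Q)).
  by rewrite -subseq_squares_by_column // mask_subseq.
by apply/gE => // x; apply: mem_mask.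
Qed.

(* The smallest corner that sees three markers is the last column and the highest
   row among them. *)
Definition has_pattern (r : nat -> nat -> nat -> bool) F P : Prop :=
  exists x y z, [/\ x \in P, y \in P, z \in P, x.1 < y.1 < z.1
    & r x.2 y.2 z.2] /\ has_square F z.1 (maxn x.2 (maxn y.2 z.2)).

Lemma avoids3P (r : nat -> nat -> nat -> bool) tau Q :
  size tau = 3 -> (forall a b c, order_isomorphic [:: a; b; c] tau <-> r a b c) ->
  {in Q &, forall x y, x.1 = y.1 -> x = y} ->
  avoids tau (standardize (heights Q)) <->
  forall x y z, x \in Q -> y \in Q -> z \in Q -> x.1 < y.1 < z.1 ->
    ~~ r x.2 y.2 z.2.
Proof.
move=> sz isoE inj; rewrite avoids_perm_of_rect //; split=> [nex x y z xQ yQ zQ|nr [t]].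
  move=> /andP[xy yz]; apply/negP => /isoE iso; apply: nex; exists [:: x; y; z] => //.
  by rewrite /= xQ yQ zQ /= [col_lt x y]xy [col_lt y z]yz.
move=> + iso; have := proj1 iso; rewrite size_map sz.
case: t iso => [|x [|y [|z [|]]]] //= /isoE rxyz _.
case/andP=> /and4P[xQ yQ zQ _] /and3P[xy yz _].
by have := nr x y z xQ yQ zQ (introT andP (conj xy yz)); rewrite rxyz.
Qed.

Lemma rook_column_inj F P : rook_placement F P ->
  {in P &, forall x y, x.1 = y.1 -> x = y}.
Proof.
move=> [_ c1 _] x y xP yP E; apply: (card_le1_eqP (c1 x.1)); rewrite !inE ?xP ?yP //=.
by rewrite E.
Qed.

Lemma placement_avoidsP (r : nat -> nat -> nat -> bool) tau F P :
  ferrers F -> longest_row F = longest_column F -> full_rook_placement F P ->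
  size tau = 3 -> (forall a b c, order_isomorphic [:: a; b; c] tau <-> r a b c) ->
  placement_avoids F tau P <-> ~ has_pattern r F P.
Proof.
move=> hF hl [hP _ _] sz isoE; have inj := rook_column_inj hP.
have bd := board_height hF hl.
have inj' V : {in P :&: rect m V &, forall x y, x.1 = y.1 -> x = y}.
  by move=> x y /setIP[xP _] /setIP[yP _]; apply: inj.
split=> [av [x [y [z [[xP yP zP xyz rxyz] sq]]]]|np V bV].
  set b := maxn _ _ in sq; have := has_squareE hF z.1 b; rewrite sq => /esym bz.
  have zn : z.1 < longest_column F by rewrite ltnNge -(board_eq0 bd); lia.
  (* The top of the right side of column [z.1] is a border vertex, and its rectangle contains all
     three markers. *)
  pose V : vertex := (z.1.+1, height F z.1).
  have bV : V \in border F.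
    by rewrite mem_border // /on_border /= zn leqnn andbT (board_homo bd).
  have inV w : w \in P -> w.1 <= z.1 -> w.2 <= b -> w \in P :&: rect m V.
    by move=> wP w1 w2; rewrite !inE wP /= ltnS w1 (leq_ltn_trans w2).
  have /andP[xy yz] := xyz.
  have /(avoids3P sz isoE (inj' V)) av' := av V bV.
  suff : ~~ r x.2 y.2 z.2 by rewrite rxyz.
  by apply: av' xyz; apply: inV => //; rewrite /b; lia.
apply/(avoids3P sz isoE (inj' V)) => x y z; rewrite !inE.
move=> /and3P[xP x1 x2] /and3P[yP y1 y2] /and3P[zP z1 z2] xyz; apply/negP => rxyz.
apply: np; exists x, y, z; split=> //.
have /and3P[_ _ le] : on_border (longest_column F) (height F) V by rewrite -mem_border.
rewrite has_squareE //; apply: leq_trans (leq_trans le (board_homo bd _)).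
  by rewrite !gtn_max x2 y2 z2.
by rewrite -ltnS (ltn_predK z1).
Qed.

Definition pattern231 a b c := c < a < b.
Definition pattern312 a b c := b < c < a.

Lemma order_isomorphic231 a b c :
  order_isomorphic [:: a; b; c] [:: 2; 3; 1] <-> pattern231 a b c.
Proof.
rewrite /pattern231; split=> [[_ iso]|/andP[ca ab]].
  by have := iso 0 1 isT isT; have := iso 2 0 isT isT => /= -> ->.
by split=> // -[|[|[|]]] [|[|[|]]] //= _ _; lia.
Qed.

Lemma order_isomorphic312 a b c :
  order_isomorphic [:: a; b; c] [:: 3; 1; 2] <-> pattern312 a b c.
Proof.
rewrite /pattern312; split=> [[_ iso]|/andP[ca ab]].
  by have := iso 1 2 isT isT; have := iso 2 0 isT isT => /= -> ->.
by split=> // -[|[|[|]]] [|[|[|]]] //= _ _; lia.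
Qed.

Lemma placement_avoids231P F P :
  ferrers F -> longest_row F = longest_column F -> full_rook_placement F P ->
  placement_avoids F [:: 2; 3; 1] P <-> ~ has_pattern pattern231 F P.
Proof. by move=> *; apply: placement_avoidsP => //; apply: order_isomorphic231. Qed.

Lemma placement_avoids312P F P :
  ferrers F -> longest_row F = longest_column F -> full_rook_placement F P ->
  placement_avoids F [:: 3; 1; 2] P <-> ~ has_pattern pattern312 F P.
Proof. by move=> *; apply: placement_avoidsP => //; apply: order_isomorphic312. Qed.

(** Transposing inverts the permutation, and 231 is the inverse of 312; the markers reappear in
    order of their rows. *)
Lemma has_pattern312_transpose F P :
  has_pattern pattern312 F P -> has_pattern pattern231 (transpose F) (transpose P).
Proof.
move=> [x [y [z [[xP yP zP xyz]]]]]; rewrite /pattern312 => yzx sq.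
exists (swap y), (swap z), (swap x); rewrite !inE !swapK; split=> //.
rewrite has_square_transpose /=.
have -> : maxn y.1 (maxn z.1 x.1) = z.1 by lia.
by have <- : maxn x.2 (maxn y.2 z.2) = x.2 by lia.
Qed.

Lemma has_pattern231_transpose F P :
  has_pattern pattern231 F P -> has_pattern pattern312 (transpose F) (transpose P).
Proof.
move=> [x [y [z [[xP yP zP xyz]]]]]; rewrite /pattern231 => zxy sq.
exists (swap z), (swap x), (swap y); rewrite !inE !swapK; split=> //.
rewrite has_square_transpose /=.
have -> : maxn z.1 (maxn x.1 y.1) = z.1 by lia.
by have <- : maxn x.2 (maxn y.2 z.2) = y.2 by lia.
Qed.

Lemma full_rook_transpose F P :
  full_rook_placement F P -> full_rook_placement (transpose F) (transpose P).
Proof.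
move=> [[sub c1 r1] fc fr]; split; [split|move=> i|move=> i].
- by apply/subsetP => x; rewrite !inE => /(subsetP sub).
- by move=> i; rewrite card_column_transpose.
- by move=> i; rewrite card_row_transpose.
- by rewrite -!card_gt0 !card_column_transpose card_gt0; apply: fr.
- by rewrite -!card_gt0 !card_row_transpose card_gt0; apply: fc.
Qed.

Lemma max_increasing_transpose P V :
  max_increasing (transpose P) (swap V) = max_increasing P V.
Proof.
apply: eq_bigl => k; apply/existsP/existsP => -[t /andP[tP st]];
  exists (map_tuple (@swap 'I_m 'I_m) t); apply/andP; split.
- by apply/allP => _ /mapP[x /(allP tP) + ->]; rewrite !inE => /and3P[/= -> -> ->].
- by rewrite sorted_map; apply: sub_sorted st => x y /andP[h1 h2]; apply/andP.
- by apply/allP => _ /mapP[x /(allP tP) + ->]; rewrite !inE swapK => /and3P[/= -> -> ->].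
- by rewrite sorted_map; apply: sub_sorted st => x y /andP[h1 h2]; apply/andP.
Qed.

End Patterns.

(** * Full placements as functions on columns *)

Section Representation.
Variables (m : nat) (F : {set square m}).
Hypotheses (hF : ferrers F) (hl : longest_row F = longest_column F).

Let n := longest_column F.
Let h := height F.
Let bd : board n h := board_height hF hl.

Definition represents (P : {set square m}) (p : nat -> nat) : Prop :=
  forall x : square m, (x \in P) = (x.1 < n) && (x.2 == p x.1 :> nat).

Let nm : n <= m.
Proof. by rewrite /n longest_columnE // height_le. Qed.

Lemma column_neq0 (i : 'I_m) : (column F i != set0) = (i < n).
Proof. by rewrite -card_gt0 card_column // lt0n (board_eq0 bd) ltnNge. Qed.

Lemma row_neq0 (j : 'I_m) : (row F j != set0) = (j < n).
Proof.
rewrite -card_gt0 -card_column_transpose card_column; last exact: ferrers_transpose.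
rewrite -has_squareE; last exact: ferrers_transpose.
by rewrite has_square_transpose has_squareE // -/h (board0 bd).
Qed.

Lemma full_rook_represents P : full_rook_placement F P ->
  exists2 p, placement n h p & represents P p.
Proof.
move=> [hP fc fr]; have [/subsetP sub c1 r1] := hP; have inj := rook_column_inj hP.
pose p i := if [pick x in P | x.1 == i :> nat] is Some x then val x.2 else 0.
have pP (x : square m) : x \in P -> p x.1 = x.2.
  move=> xP; rewrite /p; case: pickP => [y /andP[yP /eqP E]|/(_ x)]; last by rewrite xP eqxx.
  by rewrite (inj y x) //; apply: val_inj.
have ex i : i < n -> exists2 x : square m, x \in P & x.1 = i :> nat.
  move=> ni; have im := leq_trans ni nm.
  have := fc (Ordinal im); rewrite column_neq0 => /(_ ni) /eqP/cards1P[x E].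
  have : x \in column P (Ordinal im) by rewrite E set11.
  by rewrite inE => /andP[xP /eqP E']; exists x => //; rewrite E'.
have rep : represents P p.
  move=> x; apply/idP/andP => [xP|[x1 /eqP x2]].
    rewrite pP // eqxx; split=> //.
    by rewrite -column_neq0; apply/set0Pn; exists x; rewrite inE eqxx sub.
  have [y yP E] := ex _ x1; have E2 := pP y yP.
  rewrite (_ : x = y) //; case: x y E E2 x1 x2 {yP} => i j [i' j'] /= E E2 _ x2.
  by congr pair; apply: val_inj; rewrite //= x2 -E2 E.
exists p => //; split=> [i ni|i j].
  have [x xP <-] := ex i ni; rewrite pP //.
  by rewrite -has_squareE // -mem_has_square sub.
rewrite !inE => ni nj; have [x xP <-] := ex i ni; have [y yP <-] := ex j nj.
rewrite !pP // => /val_inj E.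
by rewrite (card_le1_eqP (r1 x.2) x y) // !inE ?xP ?yP //= E.
Qed.

Lemma represents_full_rook P p : placement n h p -> represents P p ->
  full_rook_placement F P.
Proof.
move=> pl rep; have [lt inj] := pl; have [h0 hh _] := bd.
have pm i : i < n -> p i < m.
  by move=> ni; apply: leq_trans (lt i ni) _; apply: height_le.
have c1 i : #|column P i| <= 1.
  apply/card_le1_eqP => x y; rewrite !inE !rep => /andP[/andP[_ /eqP x2] /eqP x1].
  move=> /andP[/andP[_ /eqP y2] /eqP y1]; case: x y x1 x2 y1 y2 => a b [c d] /= -> E -> E'.
  by congr pair; apply: val_inj; rewrite /= E E'.
have r1 j : #|row P j| <= 1.
  apply/card_le1_eqP => x y; rewrite !inE !rep => /andP[/andP[nx /eqP x2] /eqP x1].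
  move=> /andP[/andP[ny /eqP y2] /eqP y1].
  have E : x.1 = y.1 by apply/val_inj/inj; rewrite ?inE // -x2 -y2 x1 y1.
  by case: x y x1 y1 E {nx ny x2 y2} => a b [c d] /= -> -> ->.
split; first split=> //.
- apply/subsetP => x; rewrite rep mem_has_square has_squareE // => /andP[nx /eqP ->].
  exact: lt.
- move=> i; rewrite column_neq0 => ni; apply/eqP; rewrite eqn_leq c1 card_gt0.
  by apply/set0Pn; exists (i, Ordinal (pm i ni)); rewrite !inE rep /= ni !eqxx.
move=> j; rewrite row_neq0 => nj; apply/eqP; rewrite eqn_leq r1 card_gt0.
have [i ni pi] := placement_onto bd pl nj.
apply/set0Pn; exists (Ordinal (leq_trans ni nm), j).
by rewrite !inE rep /= ni pi !eqxx.
Qed.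

Lemma represents_avoids P p : placement n h p -> represents P p ->
  ~ has_pattern pattern231 F P <-> avoids231 n h p.
Proof.
move=> pl rep; have [lt inj] := pl; have [h0 hh _] := bd.
have pm i : i < n -> p i < m.
  by move=> ni; apply: leq_trans (lt i ni) _; apply: height_le.
split=> [np i j k ijk nk pijk pjh|av [x [y [z [[xP yP zP xyz]]]]]].
  have [ni nj] : i < n /\ j < n by lia.
  pose sq a (na : a < n) : square m := (Ordinal (leq_trans na nm), Ordinal (pm a na)).
  have sqP a na : sq a na \in P by rewrite rep /= na eqxx.
  apply: np; exists (sq i ni), (sq j nj), (sq k nk); split=> //.
  by rewrite has_squareE // /=; have -> : maxn (p i) (maxn (p j) (p k)) = p j by lia.
rewrite /pattern231 has_squareE //.
move: xP yP zP; rewrite !rep => /andP[nx /eqP ->] /andP[ny /eqP ->] /andP[nz /eqP ->].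
move=> pxyz sq; apply: (av x.1 y.1 z.1) => //; apply: leq_trans sq.
by rewrite ltnS !leq_max leqnn orbT.
Qed.

Lemma max_increasingE P p a b : placement n h p -> represents P p -> a <= n ->
  max_increasing P (a, b) = lis p a b.
Proof.
move=> pl rep an; have [lt inj] := pl.
have pm i : i < n -> p i < m.
  by move=> ni; apply: leq_trans (lt i ni) _; apply: height_le.
(* The top of a chain lies in some column [x.1], and the rest of the chain lies in the rectangle
   strictly to its left and below. *)
have upper t c d : c <= n -> all (mem (P :&: rect m (c, d))) t -> sorted (@right_above m) t ->
    size t <= lis p c d.
  elim/last_ind: t c d => // t x IH c d cn.
  rewrite all_rcons size_rcons => /andP[xQ tP] st.
  have : x \in P :&: rect m (c, d) by [].
  rewrite inE rep inE => /and3P[/andP[xn /eqP x2] /= xc xd].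
  rewrite x2 in xd; apply: leq_trans (lis_lt xc xd); rewrite ltnS -x2.
  have tr : transitive (@right_above m).
    by move=> u v w /andP[h1 h2] /andP[h3 h4]; apply/andP; split; apply: ltn_trans; eassumption.
  move: st; rewrite (sorted_pairwise tr) pairwise_rcons -(sorted_pairwise tr) => /andP[al st].
  apply: IH => //; first exact: ltnW.
  apply/allP => y ty; have /andP[y1 y2] := allP al y ty.
  by have := allP tP y ty; rewrite !inE /= y1 y2 => /andP[->].
(* The recursion of [lis] builds a chain that attains its value. *)
have lower c d : c <= n -> exists2 t, size t = lis p c d &
    all (mem (P :&: rect m (c, d))) t && sorted (@right_above m) t.
  elim: c d => [|c IH] d cn; first by exists [::].
  have widen t e : e <= d -> all (mem (P :&: rect m (c, e))) t ->
      all (mem (P :&: rect m (c.+1, d))) t.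
    move=> ed /allP tP; apply/allP => x /tP; rewrite !inE /= => /and3P[-> x1 x2] /=.
    by rewrite ltnS (ltnW x1) (leq_trans x2).
  have [t szt /andP[tP st]] := IH d (ltnW cn).
  have def : exists2 t, size t = lis p c d &
      all (mem (P :&: rect m (c.+1, d))) t && sorted (@right_above m) t.
    by exists t => //; rewrite st (widen t d).
  rewrite /=; case: ifP => // pc; rewrite maxnC /maxn; case: ifP => // _.
  have [t' szt' /andP[tP' st']] := IH (p c) (ltnW cn).
  pose x : square m := (Ordinal (leq_trans cn nm), Ordinal (pm c cn)).
  exists (rcons t' x); first by rewrite size_rcons szt'.
  have xQ : x \in P :&: rect m (c.+1, d) by rewrite !inE rep /= cn eqxx ltnSn pc.
  rewrite all_rcons (widen _ _ (ltnW pc) tP') [mem _ x]xQ /=.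
  case: t' tP' st' {szt'} => // y t' tP' st'; rewrite /= rcons_path [path _ _ _]st' /=.
  have : last y t' \in P :&: rect m (c, p c) by apply: (allP tP'); apply: mem_last.
  by rewrite !inE => /andP[].
apply/eqP; rewrite eqn_leq; apply/andP; split.
  by apply/bigmax_leqP => k /existsP[t /andP[tP st]]; rewrite -(size_tuple t) upper.
have [t szt tP] := lower a b an.
have lm : lis p a b < m.+1 by rewrite ltnS; apply: leq_trans (leq_lis _ _ _) (leq_trans an nm).
apply: (@leq_bigmax_cond _ _ (fun k : 'I_m.+1 => val k) (Ordinal lm)).
by apply/existsP; exists (Tuple (introT eqP szt)).
Qed.

Lemma border_statisticP P S : is_Fsequence F S ->
  border_statistic F P = S <->
  forall V, V \in border F -> max_increasing P V = value_at F S V.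
Proof.
move=> szS; split=> [<- V bV|H].
  by rewrite /value_at (nth_map V) ?index_mem // nth_index.
apply: (@eq_from_nth _ 0) => [|i]; first by rewrite size_map szS.
rewrite size_map => ib; rewrite (nth_map (0, 0)) // H ?mem_nth //.
by rewrite /value_at index_uniq ?uniq_border.
Qed.

Lemma avoiding231P (s : vertex -> nat) :
  (exists P, [/\ full_rook_placement F P, ~ has_pattern pattern231 F P
     & forall V, V \in border F -> max_increasing P V = s V]) <->
  board_conditions n h (fun a b => s (a, b)).
Proof.
split=> [[P [fP np mx]]|cs].
  have [p pl rep] := full_rook_represents fP.
  have [rs us z0 z1 dg] := necessity bd pl (proj1 (represents_avoids pl rep) np).
  have sE a b : a <= n -> h a <= b <= h a.-1 -> s (a, b) = lis p a b.
    move=> an ab; rewrite -mx ?(max_increasingE _ pl) //.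
    by rewrite mem_border // /on_border /= an.
  have [h0 hh hz] := bd.
  have hp a : h a <= h a.-1 by apply: hh; apply: leq_pred.
  split.
  - move=> a an; rewrite !sE ?leqnn ?hp ?hh //; try exact: ltnW.
    exact: rs.
  - move=> a b an /andP[ab ba]; have -> : s (a, b) = lis p a b by apply: sE; rewrite // ab ltnW.
    have -> : s (a, b.+1) = lis p a b.+1 by apply: sE; rewrite // ba leqW.
    by apply: us; rewrite ?ab.
  - by rewrite sE //= h0 leqnn.
  - by rewrite sE // -[h n]/(h n); have /eqP -> : h n == 0 by rewrite hz.
  move=> a a' b' aa hb' E above; have /andP[lt an] := aa.
  by rewrite !sE ?leqnn ?hp //; [apply: dg | lia].
have [p [pl av lisE]] := sufficiency bd cs.
pose P := [set x : square m | (x.1 < n) && (x.2 == p x.1 :> nat)].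
have rep : represents P p by move=> x; rewrite inE.
exists P; split; first exact: represents_full_rook pl rep.
  exact/(represents_avoids pl rep).
move=> [a b]; rewrite mem_border // => /and3P[/= an ab ba].
by rewrite (max_increasingE _ pl) // lisE // ab.
Qed.

End Representation.

Theorem theorem2 (m : nat) (F : {set square m}) (S : seq nat)
    (hF : ferrers F) (hlen : longest_row F = longest_column F)
    (hS : is_Fsequence F S) :
  ((exists P : {set square m},
      full_avoiding F [:: 2; 3; 1] P /\ border_statistic F P = S)
     <-> conditions231 F S)
  /\
  ((exists P : {set square m},
      full_avoiding F [:: 3; 1; 2] P /\ border_statistic F P = S)
     <-> conditions312 F S).
Proof.
have hF' := ferrers_transpose hF; have hlen' := longest_transpose hlen.
split.
  have -> : conditions231 F S <-> board_conditions (longest_column F) (height F)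
      (fun a b => value_at F S (a, b)).
    rewrite -board_conditionsP // -step_conditionsE //.
    by split=> [[? ? ?]|[[? ?] ?]].
  rewrite -avoiding231P //; split=> -[P].
    move=> [[fP av] /(border_statisticP hF hlen _ hS) mx]; exists P; split=> //.
    exact: (proj1 (placement_avoids231P hF hlen fP) av).
  move=> [fP np mx]; exists P; split; last exact/border_statisticP.
  by split=> //; apply: (proj2 (placement_avoids231P hF hlen fP)).
(* The 312 statement is the 231 statement on the transposed board, with [S] read through [swap]. *)
have -> : conditions312 F S <->
    board_conditions (longest_column (transpose F)) (height (transpose F))
      (fun a b => value_at F S (b, a)).
  rewrite -(board_conditionsP hF' hlen' (value_at F S \o @swap nat nat)).
  split=> [[mono zero dg]|[st dg]].
    split; first by apply: step_conditions_transpose => //; apply/step_conditionsE.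
    move=> V1 V2; rewrite !mem_border_transpose // => b1 b2 /diagonal_in_transpose.
    by rewrite transposeK; apply: dg.
  (* Transposing a second time brings the step conditions back to [F]. *)
  have /step_conditionsE[] // : step_conditions F (value_at F S).
    have := step_conditions_transpose hF' hlen' st; rewrite transposeK.
    by move=> [z0 z1 s]; split=> // -[a b] [c d]; apply: s.
  move=> mono zero; split=> // V1 V2 b1 b2 /diagonal_in_transpose d.
  by apply: (dg (swap V2) (swap V1)); rewrite ?mem_border_transpose ?swapK.
rewrite -(avoiding231P hF' hlen' (value_at F S \o @swap nat nat)); split=> -[P].
  move=> [[fP av] /(border_statisticP hF hlen _ hS) mx]; exists (transpose P); split.
  - exact: full_rook_transpose.
  - move=> /has_pattern231_transpose; rewrite !transposeK.
    exact: (proj1 (placement_avoids312P hF hlen fP) av).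
  - move=> V; rewrite mem_border_transpose // => bV /=.
    by rewrite -mx // -(max_increasing_transpose P) swapK.
move=> [/full_rook_transpose + np mx]; rewrite transposeK => fP.
exists (transpose P); split; last first.
  apply/border_statisticP => // V bV; have := mx (swap V).
  rewrite mem_border_transpose // /= swapK -(max_increasing_transpose P) swapK => -> //.
split=> //.
apply: (proj2 (placement_avoids312P hF hlen fP)).
by move=> /has_pattern312_transpose; rewrite transposeK.
Qed.
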